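(* The second Vénéreau polynomial $b_2 = y + x^2\bigl(xz + y(yu+z^2)\bigr) \in \mathbb{C}[x][y,z,u]$ is a $\mathbb{C}[x]$-coordinate of $\mathbb{C}[x][y,z,u]$.
   Context: For a commutative ring $A$ with one, $A^{[n]}$ denotes the polynomial ring in $n$ variables over $A$. A polynomial $f\in A^{[n]}$ is an $A$-coordinate (or simply a coordinate) if there exist $f_2,\ldots,f_n\in A^{[n]}$ with $A[f,f_2,\ldots,f_n]=A^{[n]}$. *)

(* Defs.v *)
From HB Require Import structures.
From mathcomp Require Import all_boot all_order all_algebra.
From mathcomp Require Import mpoly.
From mathcomp Require Import reals complex.

Set Implicit Arguments.
Unset Strict Implicit.
Unset Printing Implicit Defensive.

Import GRing.Theory.
Local Open Scope ring_scope.

(* With h = (h_1, ..., h_k), the equality A[h_1, ..., h_k] = A^[n]: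
   every polynomial is a polynomial expression in the h_i over A. *)
Definition generates (A : comNzRingType) (k n : nat)
    (h : k.-tuple {mpoly A[n]}) : Prop :=
  forall p : {mpoly A[n]}, exists q : {mpoly A[k]}, p = q \mPo h.

(* The number of variables is n.+1, so that f is completed by the n-tuple
   g = (f_2, ..., f_n.+1). *)
Definition coordinate (A : comNzRingType) (n : nat)
    (f : {mpoly A[n.+1]}) : Prop :=
  exists g : n.-tuple {mpoly A[n.+1]}, generates [tuple of f :: g].

Section Venereau.

Variable C : comNzRingType.

(* In {mpoly {poly C}[3]}, the variables y, z, u have indices 0, 1, 2,
   whereas x is the indeterminate of the coefficient ring {poly C}. *)
Local Notation x := (('X : {poly C})%:MP_[3]).
Local Notation y := ('X_(inord 0) : {mpoly {poly C}[3]}).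
Local Notation z := ('X_(inord 1) : {mpoly {poly C}[3]}).
Local Notation u := ('X_(inord 2) : {mpoly {poly C}[3]}).

Definition venereau2 : {mpoly {poly C}[3]} :=
  y + x ^+ 2 * (x * z + y * (y * u + z ^+ 2)).

End Venereau.

(* Main.v *)
Require Import Defs.
From mathcomp Require Import all_boot all_order all_algebra.
From mathcomp Require Import mpoly.
From mathcomp Require Import reals complex.
From mathcomp Require Import ring.

(** Put [p = y u + z^2], [v = x z + y p] and [w = x^2 u - 2 x z p - y p^2], so
    that [b = y + x^2 v] and [y w + v^2 = x^2 p].  Over [C[x, 1/x]] the triple
    [(b, v, w)] is a coordinate system, and the automorphisms of
    [C[x, 1/x, b][v, w]] may be used to make the last two coordinates integral
    at [x = 0] without losing generation.  From [b w + v^2 = x^2 (p + v w)] it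
    follows that the linear shear [v' = v - x^2 w / 2] cancels the term [v w]:
      [b w + v'^2 = x^2 p'],  with [p' = p + x^2 w^2 / 4].
    The Nagata-type substitution inverse to [(y, z, u) |-> (y, v, w)],
      [z' = (v' - b p') / x],  [u' = (w + 2 x z' p' + b p'^2) / x^2],
    now has polynomial values because [b = y], [p' = p] and [z' = z] up to
    multiples of [x^2], [x^2] and [x], and [(b, z', u')] generates. *)

Set Implicit Arguments.
Unset Strict Implicit.
Unset Printing Implicit Defensive.

Import GRing.Theory.
Local Open Scope ring_scope.

Section Expressible.

Variables (A : comNzRingType) (k n : nat) (h : k.-tuple {mpoly A[n]}).

Definition expressible (p : {mpoly A[n]}) : Prop :=
  exists q : {mpoly A[k]}, p = q \mPo h.

Lemma expressibleC (c : A) : expressible c%:MP.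
Proof. by exists c%:MP; rewrite comp_mpolyC. Qed.

Lemma expressible_tnth (i : 'I_k) : expressible (tnth h i).
Proof. by exists 'X_i; rewrite comp_mpolyXU -tnth_nth. Qed.

Lemma expressibleD p q : expressible p -> expressible q -> expressible (p + q).
Proof. by move=> [p' ->] [q' ->]; exists (p' + q'); rewrite comp_mpolyD. Qed.

Lemma expressibleN p : expressible p -> expressible (- p).
Proof. by move=> [p' ->]; exists (- p'); rewrite comp_mpolyN. Qed.

Lemma expressibleM p q : expressible p -> expressible q -> expressible (p * q).
Proof. by move=> [p' ->] [q' ->]; exists (p' * q'); rewrite rmorphM. Qed.

Lemma expressibleX p m : expressible p -> expressible (p ^+ m).
Proof. by move=> [p' ->]; exists (p' ^+ m); rewrite rmorphXn. Qed.

Lemma expressibleMn p m : expressible p -> expressible (p *+ m).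
Proof. by move=> [p' ->]; exists (p' *+ m); rewrite comp_mpolyMn. Qed.

(** Expressible polynomials form an [A]-subalgebra, so containing the variables suffices. *)
Lemma generates_vars : (forall i, expressible 'X_i) -> generates h.
Proof.
move=> hX; elim/mpolyind=> [|c m p _ _ hp].
  by rewrite -mpolyC0; apply: expressibleC.
apply: expressibleD => //; rewrite -mul_mpolyC mpolyXE_id.
apply: expressibleM; first exact: expressibleC.
apply: (big_ind expressible) => [|p1 p2|i _].
- by rewrite -mpolyC1; apply: expressibleC.
- exact: expressibleM.
- exact: expressibleX.
Qed.

End Expressible.

Lemma venereau2_coordinate (C : comNzRingType) (c : C) :
  c *+ 2 = 1 -> coordinate (venereau2 C).
Proof.
move=> c2; rewrite /venereau2.
set x := ('X)%:MP; set y := 'X_(inord 0); set z := 'X_(inord 1).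
set u := 'X_(inord 2); set b := (X in coordinate X).
pose e : {mpoly {poly C}[3]} := (c%:P)%:MP.
have e2 : 1 - e *+ 2 = 0 by rewrite -mpolyCMn -polyCMn c2 subrr.
pose p := y * u + z ^+ 2; pose v := x * z + y * p.
pose w := x ^+ 2 * u - x * z * p *+ 2 - y * p ^+ 2.
pose s := e ^+ 2 * w ^+ 2; pose p' := p + x ^+ 2 * s.
(* Here [e] is 1/2; [a] and [d] are chosen so that [x z' = v - e x^2 w - b p'] and
   [x^2 u' = w + 2 x z' p' + b p'^2]. *)
pose a := e * w + v * p + b * s; pose z' := z - x * a.
pose d := x * z * s *+ 2 - a * p *+ 2 - x ^+ 2 * a * s *+ 2 + v * p' ^+ 2
          + y * p * s *+ 2 + x ^+ 2 * y * s ^+ 2.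
pose u' := u + d.
exists [tuple z'; u']; set h := [tuple of _].
have Eh j : (j < 3)%N -> expressible h (nth 0 h j).
  by move=> lt_j3; have := expressible_tnth h (Ordinal lt_j3);
    rewrite (tnth_nth 0).
have Eb : expressible h b by exact: (Eh 0%N).
have Ez' : expressible h z' by exact: (Eh 1%N).
have Eu' : expressible h u' by exact: (Eh 2).
have Ex : expressible h x by apply: expressibleC.
have Ee : expressible h e by apply: expressibleC.
have HD := @expressibleD _ _ _ h; have HN := @expressibleN _ _ _ h.
have HM := @expressibleM _ _ _ h; have HX := @expressibleX _ _ _ h.
have HMn := @expressibleMn _ _ _ h.
have bE : b = y + x ^+ 2 * v by [].
have Ep' : expressible h p'.
  (* The analogue of [p = y u + z^2]; since [ring] does not know [2 e = 1], the defect is kept as a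
     term. *)
  have -> : p' = b * u' + z' ^+ 2 - (1 - e *+ 2) * (v * w).
    by rewrite /u' /d /z' /a /p' /s bE /w /v /p; ring.
  by rewrite e2 mul0r subr0; auto.
have Ew : expressible h w.
  have -> : w = x ^+ 2 * u' - x * z' * p' *+ 2 - b * p' ^+ 2.
    by rewrite /u' /d /z' /p' bE; rewrite /w; ring.
  by auto 10.
have Es : expressible h s by rewrite /s; auto.
have Ev : expressible h v.
  have -> : v = x * z' + b * p' + e * x ^+ 2 * w.
    by rewrite /z' /a /p' bE {1}/v; ring.
  by auto.
(* From here the definitions are undone one by one. *)
have Ep : expressible h p by rewrite -[p](addrK (x ^+ 2 * s)); auto.
have Ey : expressible h y by rewrite -[y](addrK (x ^+ 2 * v)) -bE; auto.
have Ea : expressible h a by rewrite /a; auto 10.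
have Ez : expressible h z by rewrite -[z](subrK (x * a)); auto.
have Eu : expressible h u.
  rewrite -[u](addrK d); apply: (HD) => //; apply: (HN); rewrite /d.
  by auto 20.
apply: generates_vars => j; rewrite -[j]inord_val.
by case: j => [[|[|[|//]]] ?].
Qed.

Theorem theorem5 (R : realType) :
  coordinate (@venereau2 R[i]).
Proof.
apply: (@venereau2_coordinate _ 2%:R^-1).
by rewrite -[_^-1 *+ _]mulr_natr mulVf // Num.Theory.pnatr_eq0.
Qed.
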